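(* Let $F$ be a field and let $m(x)=x^3+ax^2+bx+c\in F[x]$ be irreducible. Let $A,B,C\in\mathcal{C}(m)$ be distinct. If $B-A$ is invertible and $C-A$ is singular, then $\mathcal{V}(A,B,C)$ is invertible.
   Context: $M_3(F)$ is the ring of $3\times 3$ matrices over $F$. $\mathcal{C}(m)$ is the set of all $A\in M_3(F)$ whose minimal polynomial is $m$. $\mathcal{V}(A,B,C)$ denotes the $9\times 9$ block Vandermonde matrix $\begin{bmatrix} I&I&I\\ A&B&C\\ A^2&B^2&C^2\end{bmatrix}$, where $I$ is the $3\times 3$ identity matrix. *)

(* Defs.v *)
From HB Require Import structures.
From mathcomp Require Import all_boot all_order all_algebra.

Set Implicit Arguments.
Unset Strict Implicit.
Unset Printing Implicit Defensive.

Import GRing.Theory.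
Local Open Scope ring_scope.

Definition minpoly_class (F : fieldType) (m : {poly F}) : {pred 'M[F]_3} :=
  [pred A | mxminpoly A == m].

Definition block_vandermonde (F : fieldType) (A B C : 'M[F]_3) :
    'M[F]_(3 + (3 + 3)) :=
  col_mx (row_mx 1%:M (row_mx 1%:M 1%:M))
    (col_mx (row_mx A (row_mx B C))
            (row_mx (A ^+ 2) (row_mx (B ^+ 2) (C ^+ 2)))).

(* Main.v *)
(** Let s = (B^2 - A^2)(B - A)^-1.  Block elimination reduces invertibility of
    the Vandermonde matrix to that of the Schur complement
    W = (C^2 - A^2) - s (C - A), the value at C of the monic quadratic with
    left coefficients that annihilates A and B.  This quadratic is a right
    factor of m, so W C = T W for some T, and the row space of W is C-stable.
    As m is irreducible of degree 3, C has no proper nonzero stable subspace: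
    W is either invertible or zero.  In the latter case (C - A) A = (s - C)(C - A),
    so likewise C - A is invertible or zero, against the hypotheses. *)
Require Import Defs.
From mathcomp Require Import all_boot all_order all_algebra.

Set Implicit Arguments.
Unset Strict Implicit.
Unset Printing Implicit Defensive.

Import GRing.Theory.
Local Open Scope ring_scope.

(** An irreducible polynomial is coprime to any nonzero polynomial of smaller degree; evaluating the
    Bezout identity at [A] kills the [mxminpoly A] term and leaves an inverse of [horner_mx A p]. *)
Lemma horner_mx_irreducible_unit (F : fieldType) (n : nat)
    (A : 'M[F]_n.+1) (p : {poly F}) :
    irreducible_poly (mxminpoly A) -> p != 0 ->
    (size p < size (mxminpoly A))%N ->
  horner_mx A p \in unitmx.
Proof.
move=> irrA p0 ltp.
have /Bezout_eq1_coprimepP[[u v] /= /(congr1 (horner_mx A))] :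
    coprimep (mxminpoly A) p.
  rewrite /coprimep; apply: contraT => ngcd1.
  have /eqp_size sz := irrA.2 _ ngcd1 (dvdp_gcdl _ _).
  by have := leq_gcdpr (mxminpoly A) p0; rewrite sz leqNgt ltp.
rewrite rmorphD !rmorphM rmorph1 /= mx_root_minpoly mulr0 add0r => uv1.
by case: (mulmx1_unit uv1).
Qed.

(** Krylov argument: for a nonzero [r] in the row space of [M], the [n.+1] vectors [r *m A ^+ i]
    stay in that space and are independent, so it is the full space. *)
Lemma stable_irreducible_unit (F : fieldType) (n : nat) (A M : 'M[F]_n.+1) :
    irreducible_poly (mxminpoly A) -> size (mxminpoly A) = n.+2 ->
    stablemx M A -> M != 0 ->
  M \in unitmx.
Proof.
move=> irrA szA stM /rowV0Pn[r rM r0].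
pose K := \matrix_(i < n.+1) (r *m A ^+ i).
have KM : (K <= M)%MS.
  apply/row_subP=> i; rewrite rowK; elim: (i : nat) => [|k IHk].
    by rewrite expr0 mulmx1.
  by rewrite exprSr mulmxA; apply: submx_trans stM; apply: submxMr.
rewrite -row_full_unit -col_leq_rank; apply: leq_trans (mxrankS KM).
suff /eqP-> : row_free K by [].
rewrite -kermx_eq0; apply/rowV0P=> v /sub_kermxP vK.
apply/eqP; apply: contraNT r0 => v0.
(* A relation [v] among the Krylov rows is a polynomial of degree at most [n] whose value at [A]
   kills [r]; if [v] were nonzero, that value would be invertible. *)
have pU : horner_mx A (rVpoly v) \in unitmx.
  apply: horner_mx_irreducible_unit; rewrite ?szA ?ltnS ?size_poly //.
  by apply: contra v0 => /eqP p0; rewrite -[v]rVpolyK p0 linear0.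
have rp0 : r *m horner_mx A (rVpoly v) = 0.
  rewrite -vK horner_rVpoly [RHS]mulmx_sum_row.
  rewrite [X in vec_mx X]mulmx_sum_row linear_sum /= mulmx_sumr.
  apply: eq_bigr => i _.
  by rewrite rowK rowK linearZ /= mxvecK -scalemxAr.
by rewrite -[r](mulmxK pU) rp0 mul0mx.
Qed.

Lemma cubic_schur_intertwine (F : fieldType) (R : unitAlgType F)
    (a b c : F) (A B C : R) :
    A ^+ 3 + a *: A ^+ 2 + b *: A + c%:A = 0 ->
    B ^+ 3 + a *: B ^+ 2 + b *: B + c%:A = 0 ->
    C ^+ 3 + a *: C ^+ 2 + b *: C + c%:A = 0 ->
    B - A \is a GRing.unit ->
  let s := (B ^+ 2 - A ^+ 2) / (B - A) in
  let W := C ^+ 2 - A ^+ 2 - s * (C - A) in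
  W * C = - (a%:A + s) * W.
Proof.
move=> fA fB fC uD s W.
(* [- g] is the coefficient of [X - A] once the cubic relation has removed [X ^+ 3] from the
   quadratic at [X] times [X]. *)
pose g := b%:A + A ^+ 2 - s * A.
have step X : X ^+ 3 + a *: X ^+ 2 + b *: X + c%:A = 0 ->
    (X ^+ 2 - A ^+ 2 - s * (X - A)) * X =
    - (a%:A + s) * (X ^+ 2 - A ^+ 2) - g * (X - A).
  move=> fX.
  have fXA : X ^+ 3 - A ^+ 3 + a *: (X ^+ 2 - A ^+ 2) + b *: (X - A) = 0.
    rewrite !scalerBr -[RHS](subrr 0) -{1}fX -fA.
    rewrite opprD [RHS]addrACA subrr addr0 opprD [RHS]addrACA opprD.
    by rewrite [X in _ = X + _]addrACA.
  have E3 : X ^+ 3 - A ^+ 3 = (X ^+ 2 - A ^+ 2) * X + A ^+ 2 * (X - A).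
    by rewrite mulrBl mulrBr -!exprSr addrA subrK.
  have E2 : X ^+ 2 - A ^+ 2 = (X - A) * X + A * (X - A).
    by rewrite mulrBl mulrBr -!expr2 addrA subrK.
  have /eqP := fXA; rewrite -addrA addr_eq0 E3 => /eqP/(canRL (addrK _)) E2X.
  have /esym/(canRL (addrK _)) EX := E2.
  rewrite mulrBl E2X -(mulrA s) EX (mulrBr s) mulNr mulrDl mulr_algl.
  rewrite /g mulrBl mulrDl mulr_algl -(mulrA s) !opprD !opprK !addrA.
  by rewrite [LHS](ACl (1*4*2*3*5)).
(* At [X = B] the quadratic vanishes by the choice of [s], so [step] determines [g] after cancelling
   [B - A]. *)
have gE : g = - (a%:A + s) * s.
  apply: (mulIr uD); have := step B fB.
  rewrite divrK // subrr mul0r => /esym/eqP; rewrite subr_eq0 => /eqP<-.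
  by rewrite -[RHS]mulrA divrK.
by rewrite step // gE -mulrA -mulrBr.
Qed.

Theorem theorem4p2 (F : fieldType) (a b c : F) (m : {poly F})
    (m_def : m = 'X^3 + a *: 'X^2 + b *: 'X + c%:P)
    (m_irr : irreducible_poly m)
    (A B C : 'M[F]_3)
    (mA : A \in minpoly_class m) (mB : B \in minpoly_class m)
    (mC : C \in minpoly_class m)
    (neqAB : A != B) (neqAC : A != C) (neqBC : B != C)
    (BA_unit : B - A \in unitmx) (CA_sing : C - A \notin unitmx) :
  block_vandermonde A B C \in unitmx.
Proof.
have szm : size m = 4%N.
  rewrite m_def -addrA -addrA size_polyDl size_polyXn // ltnS.
  apply: leq_trans (size_polyD _ _) _; rewrite geq_max.
  rewrite (leq_trans (size_scale_leq _ _)) ?size_polyXn //=.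
  apply: leq_trans (size_polyD _ _) _; rewrite geq_max.
  rewrite (leq_trans (size_scale_leq _ _)) ?size_polyX //=.
  by rewrite (leq_trans (size_polyC_leq1 _)).
have cubic X : X \in minpoly_class m ->
    X ^+ 3 + a *: X ^+ 2 + b *: X + c%:A = 0.
  rewrite inE => /eqP mX; have := mx_root_minpoly X; rewrite mX m_def.
  rewrite !rmorphD /= !linearZ /= !rmorphXn /= horner_mx_X horner_mx_C.
  by rewrite scalemx1.
have unitS X M T : X \in minpoly_class m -> M * X = T * M -> M != 0 ->
    M \in unitmx.
  rewrite inE => /eqP mX MX; apply: (@stable_irreducible_unit _ _ X).
  - by rewrite mX.
  - by rewrite mX.
  - by rewrite -[M *m X]/(M * X) MX submxMl.
pose s := (B ^+ 2 - A ^+ 2) / (B - A).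
pose W := C ^+ 2 - A ^+ 2 - s * (C - A).
have sD : s * (B - A) = B ^+ 2 - A ^+ 2 by rewrite divrK.
have WC : W * C = - (a%:A + s) * W.
  by apply: (cubic_schur_intertwine (cubic A mA) (cubic B mB) (cubic C mC)).
have W0 : W != 0.
  apply: contraNneq CA_sing => /eqP; rewrite subr_eq0 => /eqP W0.
  apply: (unitS A _ (s - C)) => //; last by rewrite subr_eq0 eq_sym.
  rewrite (mulrBl _ s) -W0 mulrBr mulrBl !expr2 opprB.
  by rewrite [RHS]addrC addrA subrK.
have WU : W \in unitmx by apply: unitS WC W0.
(* A left kernel vector splits as [(u, v, w)] with [u + v X + w X^2 = 0] at [A], [B], [C].
   Subtracting the equation at [A] removes [u]; then [B] gives [v = - w s] and [C] gives
   [w W = 0]. *)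
rewrite -row_free_unit -kermx_eq0; apply/rowV0P=> x /sub_kermxP.
rewrite -[x]hsubmxK -[rsubmx x]hsubmxK.
move: (lsubmx x) (lsubmx (rsubmx x)) (rsubmx (rsubmx x)) => u v w.
rewrite /block_vandermonde !mul_row_col !mul_mx_row !add_row_mx !mulmx1.
rewrite -[0]hsubmxK => /eq_row_mx[]; rewrite linear0 => eA.
rewrite -[rsubmx _]hsubmxK => /eq_row_mx[]; rewrite !linear0 => eB eC.
have elim X : u + (v *m X + w *m X ^+ 2) = 0 ->
    v *m (X - A) + w *m (X ^+ 2 - A ^+ 2) = 0.
  rewrite -eA => /addrI eX.
  by rewrite !mulmxBr addrACA -opprD eX subrr eA.
have vE : v = - (w *m s).
  have /eqP := elim B eB; rewrite -sD mulmxA -mulmxDl => /eqP vs0.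
  by apply/eqP; rewrite -addr_eq0 -[v + _](mulmxK BA_unit) vs0 mul0mx.
have w0 : w = 0.
  have := elim C eC; rewrite vE mulNmx -mulmxA addrC -mulmxBr => wW.
  by rewrite -[w](mulmxK WU) [w *m W]wW mul0mx.
move: eA; rewrite vE w0 !mul0mx oppr0 !mul0mx !addr0 => ->.
by rewrite !row_mx0.
Qed.
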